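(* Let $\tau>0$, let $\theta$ be the given contact-angle parameter, and let $\Gamma_h^m\subset\mathbb{R}^3$ be a triangulated open surface whose boundary $\partial\Gamma_h^m$ (the contact line) is a closed polygonal curve in the substrate plane $\{x_3=0\}$. Suppose that $$(v_h^{m+1},H_h^{m+1},\lambda_h^{m+1},\kappa_h^{m+1})\in\mathbf{X}_h(\Gamma_h^m)\times S_h(\Gamma_h^m)\times\mathbf{X}_h(\Gamma_h^m)\times S_h(\Gamma_h^m)$$ satisfies, for all $(w_h,\phi_h,\eta_h,\varphi_h)\in\mathbf{X}_h(\Gamma_h^m)\times S_h(\Gamma_h^m)\times\mathbf{X}_h(\Gamma_h^m)\times S_h(\Gamma_h^m)$, $$-\int_{\Gamma_h^m}^{(h)}H_h^{m+1}n_h^m\cdot w_h+\int_{\Gamma_h^m}\nabla_{\Gamma_h^m}(\mathrm{id}+\tau v_h^{m+1})\cdot\nabla_{\Gamma_h^m}w_h-\int_{\partial\Gamma_h^m}\cos\theta\; n_\partial^{m+\frac12}\cdot w_h=a_{\Gamma_h^m}(\lambda_h^{m+1},w_h),$$ $$\int_{\Gamma_h^m}^{(h)}(v_h^{m+1}\cdot n_h^m)\phi_h+\int_{\Gamma_h^m}\nabla_{\Gamma_h^m}H_h^{m+1}\cdot\nabla_{\Gamma_h^m}\phi_h=0,$$ $$a_{\Gamma_h^m}(v_h^{m+1},\eta_h)=\int_{\Gamma_h^m}^{(h)}\kappa_h^{m+1}n_h^m\cdot\eta_h,$$ $$\int_{\Gamma_h^m}^{(h)}\lambda_h^{m+1}\cdot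 n_h^m\,\varphi_h=0,$$ where, with $X_h^{m+1}=\mathrm{id}+\tau v_h^{m+1}$, $$n_\partial^{m+\frac12}:=\tfrac12\bigl(\partial_s\mathrm{id}+\partial_sX_h^{m+1}\bigr)\times e_3 .$$ Let $\Gamma_h^{m+1}:=X_h^{m+1}(\Gamma_h^m)$. Then $$|\Gamma_h^{m+1}|-\cos\theta\,|S_1^{m+1}|\le|\Gamma_h^m|-\cos\theta\,|S_1^m| ,$$ where $S_1^m$ denotes the planar domain enclosed by the contact line $\partial\Gamma_h^m$ on the substrate (and $S_1^{m+1}$ the one enclosed by $\partial\Gamma_h^{m+1}$).
   Context: $\Gamma_h^m=\bigcup_{K\in\mathcal{K}_h^m}K$ is a polyhedral surface with boundary, the union of a finite set $\mathcal{K}_h^m$ of flat, conforming, nondegenerate triangles; $q_{K,0},q_{K,1},q_{K,2}$ are the vertices of $K$, $|K|$ its area, and $n_h^m$ the piecewise-constant unit normal vector on $\Gamma_h^m$. Finite element spaces: $S_h(\Gamma_h^m)=\{v_h\in C^0(\Gamma_h^m): v_h|_K\text{ is affine for all }K\in\mathcal{K}_h^m\}$; $\mathring S_h(\Gamma_h^m)$ is the subspace of functions vanishing on $\partial\Gamma_h^m$; $\mathbf{X}_h(\Gamma_h^m):=S_h(\Gamma_h^m)\times S_h(\Gamma_h^m)\times\mathring S_h(\Gamma_h^m)$ (so the third component of a field in $\mathbf{X}_h(\Gamma_h^m)$ vanishes on the contact line). Mass-lumped integral: for (possibly discontinuous across elements) piecewise-defined $u,w$, $$\int_{\Gamma_h^m}^{(h)}u\cdot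 w:=\sum_{K\in\mathcal{K}_h^m}\frac{|K|}{3}\sum_{j=0}^2 (u\cdot w)|_K(q_{K,j}).$$ $\nabla_{\Gamma_h^m}$ is the elementwise surface (tangential) gradient on $\Gamma_h^m$, applied componentwise to vector-valued functions, with the Frobenius inner product between gradients of vector fields. $\mathrm{id}(x)=x$. $a_\Gamma(\cdot,\cdot)$ is a symmetric bilinear form on vector fields over a surface $\Gamma$, positive definite when restricted to the tangential subspace, used to define the tangential motion; for example the one with $a_\Gamma(v,v)=\int_\Gamma\frac12|\nabla_\Gamma v|^2$ or $a_\Gamma(v,v)=\int_\Gamma\frac12|\nabla_\Gamma v+(\nabla_\Gamma v)^{\mathrm T}|^2$. $a_{\Gamma_h^m}(\cdot,\cdot)$ is the corresponding symmetric bilinear form on $\Gamma_h^m$. $e_3=(0,0,1)$, and $s$ is the arc-length parameter along the discrete boundary curve $\partial\Gamma_h^m$, oriented so that $\partial_s\mathrm{id}\times e_3$ is the outward unit normal of $\partial\Gamma_h^m$ within the substrate plane (counterclockwise seen from above). $|\Gamma_h^m|=\sum_{K}|K|$ is the discrete surface area, and $|\Gamma_h^{m+1}|=\sum_K|X_h^{m+1}(K)|$. $|S_1^m|$ and $|S_1^{m+1}|$ are the areas of the planar domains enclosed by $\partial\Gamma_h^m$ and by $\partial\Gamma_h^{m+1}=X_h^{m+1}(\partial\Gamma_h^m)$, where enclosed area is understood with respect to the orientation of the curves induced by $s$ (i.e. as the signed area, which equals the usual area when the curve is simple and counterclockwise oriented). *)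

(* Defs.v *)
From HB Require Import structures.
From mathcomp Require Import all_boot all_order all_algebra.
From mathcomp Require Import all_classical all_reals all_analysis.

Set Implicit Arguments.
Unset Strict Implicit.
Unset Printing Implicit Defensive.

Import Order.TTheory GRing.Theory Num.Theory.
Import numFieldNormedType.Exports.

Local Open Scope classical_set_scope.
Local Open Scope ring_scope.

Section Euclidean3.
Variable R : realType.
Local Notation vec := 'rV[R]_3.
Implicit Types (x y n t : vec).

Definition dotv x y : R := \sum_(i < 3) x 0 i * y 0 i.

(* The library norm of a row vector is the sup norm, hence this definition. *)
Definition enorm x : R := Num.sqrt (dotv x x).

(* Indices are cyclic: (x * y)_i = x_(i+1) y_(i+2) - x_(i+2) y_(i+1) mod 3. *)
Definition crossv x y : vec :=
  \row_(i < 3) (x 0 (ordS i) * y 0 (ordS (ordS i))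
                - x 0 (ordS (ordS i)) * y 0 (ordS i)).

Definition e3 : vec := delta_mx 0 ord_max.

Definition comp (v : vec -> vec) (i : 'I_3) : vec -> R := fun x => v x 0 i.

Definition substrate : set vec := [set x | x 0 ord_max = 0].

Definition segment x y : set vec :=
  [set z | exists2 t : R, 0 <= t <= 1 & z = (1 - t) *: x + t *: y].

Definition open_segment x y : set vec :=
  [set z | exists2 t : R, 0 < t < 1 & z = (1 - t) *: x + t *: y].

Section Triangle.
Variable T : 'I_3 -> vec.

(* The convex hull of those vertices of T which belong to A. *)
Definition face (A : set vec) : set vec :=
  [set x | exists b : 'I_3 -> R,
     [/\ forall i, 0 <= b i, \sum_(i < 3) b i = 1,
         forall i, b i != 0 -> A (T i) & x = \sum_(i < 3) b i *: T i]].

Definition triangle : set vec := face setT.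

Definition area_vec : vec := crossv (T 1 - T 0) (T 2 - T 0).

Definition area : R := 2^-1 * enorm area_vec.

Definition normal : vec := (enorm area_vec)^-1 *: area_vec.

(* The surface integral over T, pulled back to the reference triangle
   {(s, t) | 0 < s, 0 < t, s + t < 1} by the affine parametrization of T,
   whose Jacobian is 2 * area. *)
Definition int_triangle (f : vec -> R) : R :=
  2 * area *
  (\int[@lebesgue_measure R]_(s in `]0%R, 1%R[)
    (\int[@lebesgue_measure R]_(t in `]0%R, (1 - s)%R[)
      f (T 0 + s *: (T 1 - T 0) + t *: (T 2 - T 0)))).

End Triangle.

(* The orthogonal projection of x on the plane normal to the unit vector n. *)
Definition tproj n x : vec := x - dotv n x *: n.

(* The i-th component of the tangential gradient is the derivative in the
   direction of the tangential part of the i-th basis vector; at an interior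
   point of a flat triangle with unit normal n, it only involves the values
   of u on that triangle. *)
Definition tgrad n (u : vec -> R) x : vec :=
  \row_(i < 3) 'D_(tproj n (delta_mx 0 i)) u x.

Definition tgradv n (v : vec -> vec) x : 'M[R]_3 :=
  \matrix_(i < 3, j < 3) tgrad n (comp v i) x 0 j.

Definition frobenius (A B : 'M[R]_3) : R :=
  \sum_(i < 3) \sum_(j < 3) A i j * B i j.

Definition affine_on (A : set vec) (u : vec -> R) : Prop :=
  exists (g : vec) (c : R), forall x, A x -> u x = dotv g x + c.

End Euclidean3.

Section TriangulatedSurface.
Variables (R : realType) (F : finType).
Local Notation vec := 'rV[R]_3.

(* A finite family of triangles: q K j is the j-th vertex of K. The order of
   the vertices also fixes the orientation of K and hence its unit normal. *)
Variable q : F -> 'I_3 -> vec.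

Definition is_vertex (K : F) (x : vec) : bool := [exists j, q K j == x].

Definition surface : set vec := [set x | exists K, triangle (q K) x].

Definition boundary_edge (x y : vec) : Prop :=
  x != y /\ #|[set K | is_vertex K x && is_vertex K y]%SET| = 1%N.

Definition boundary : set vec :=
  [set z | exists x y, boundary_edge x y /\ segment x y z].

Definition star_adjacent (x : vec) : rel F :=
  [rel K L | [&& is_vertex K x, is_vertex L x &
              [exists j, (q K j != x) && is_vertex L (q K j)]]].

(* surface_coherent says that two triangles sharing an edge run through it in
   opposite directions; in particular, an edge belongs to at most two
   triangles. Then surface_star says that the triangles around a vertex form
   a single fan or a single cycle, i.e. that the surface is a manifold with
   boundary. *)
Record triangulated_surface : Prop := {
  surface_nondegenerate : forall K, area_vec (q K) != 0;
  surface_distinct : forall K L, K != L -> exists j, ~~ is_vertex L (q K j);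
  surface_conforming : forall K L, K != L ->
    triangle (q K) `&` triangle (q L) = face (q K) [set x | is_vertex L x];
  surface_coherent : forall K L i j, q K i = q L j ->
    q K (ordS i) = q L (ordS j) -> K = L;
  surface_star : forall x K L, is_vertex K x -> is_vertex L x ->
    connect (star_adjacent x) K L
}.

(* Scalar and vector fields on the surface are represented by functions
   defined on the whole space, of which only the restriction to the surface
   is relevant. *)
Definition Sh (u : vec -> R) : Prop :=
  {within surface, continuous u} /\
  forall K, affine_on (triangle (q K)) u.

Definition Sh0 (u : vec -> R) : Prop :=
  Sh u /\ forall x, boundary x -> u x = 0.

Definition Xh (v : vec -> vec) : Prop :=
  [/\ Sh (comp v 0), Sh (comp v 1) & Sh0 (comp v ord_max)].

(* Integrands are elementwise: f K is the integrand on the triangle K. *)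
Definition int_lumped (f : F -> vec -> R) : R :=
  \sum_K area (q K) / 3 * \sum_(j < 3) f K (q K j).

Definition int_surface (f : F -> vec -> R) : R :=
  \sum_K int_triangle (q K) (f K).

(* The last clause says that a only depends on the fields on the surface. *)
Record symmetric_bilinear_form (a : (vec -> vec) -> (vec -> vec) -> R)
    : Prop := {
  form_sym : forall v w, Xh v -> Xh w -> a v w = a w v;
  form_linear : forall (c : R) v v' w, Xh v -> Xh v' -> Xh w ->
    a (fun x => c *: v x + v' x) w = c * a v w + a v' w;
  form_ext : forall v v' w, Xh v -> Xh v' -> Xh w ->
    (forall x, surface x -> v x = v' x) -> a v w = a v' w
}.

End TriangulatedSurface.

(* Closed polygonal curves p_0 p_1 ... p_(N-1) p_0; ordS is the cyclic
   successor on 'I_N. *)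
Section Polygon.
Variables (R : realType) (N : nat) (p : 'I_N -> 'rV[R]_3).
Local Notation vec := 'rV[R]_3.

Definition edge_length (i : 'I_N) : R := enorm (p (ordS i) - p i).

Definition edge_tangent (i : 'I_N) : vec :=
  (edge_length i)^-1 *: (p (ordS i) - p i).

Definition arc_deriv (i : 'I_N) (f : vec -> vec) (x : vec) : vec :=
  'D_(edge_tangent i) f x.

Definition int_polygon (f : 'I_N -> vec -> R) : R :=
  \sum_(i < N) \int[@lebesgue_measure R]_(s in `]0%R, (edge_length i)[)
    f i (p i + s *: edge_tangent i).

Definition polygon : set vec :=
  [set x | exists i, segment (p i) (p (ordS i)) x].

(* The union of the bounded components of the complement in the substrate. *)
Definition enclosed_domain : set vec :=
  [set x | (substrate (R := R) `\` polygon) x /\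
           bounded_set (connected_component (substrate (R := R) `\` polygon) x)].

Definition outward_oriented : Prop :=
  forall i x, open_segment (p i) (p (ordS i)) x ->
    \forall e \near 0^'+,
      ~ enclosed_domain (x + e *: crossv (edge_tangent i) (@e3 R)) /\
      enclosed_domain (x - e *: crossv (edge_tangent i) (@e3 R)).

(* The signed area enclosed by a closed polygon in the substrate (shoelace
   formula), positive for simple counterclockwise polygons. *)
Definition signed_area : R :=
  2^-1 * \sum_(i < N) crossv (p i) (p (ordS i)) 0 ord_max.

(* The half-step conormal: half the sum of the arc-length derivatives of id
   and of X, times e3. *)
Definition conormal_half (X : vec -> vec) (i : 'I_N) (x : vec) : vec :=
  crossv (2^-1 *: (arc_deriv i id x + arc_deriv i X x)) (@e3 R).

End Polygon.

(* The boundary of the surface is the simple closed polygon p, which lies in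
   the substrate and is oriented by its outward normal. *)
Record contact_line (R : realType) (F : finType) (q : F -> 'I_3 -> 'rV[R]_3)
    (N : nat) (p : 'I_N -> 'rV[R]_3) : Prop := {
  contact_size : (2 < N)%N;
  contact_simple : injective p;
  contact_boundary : forall x y, boundary_edge q x y <->
    exists i, (x = p i /\ y = p (ordS i)) \/ (y = p i /\ x = p (ordS i));
  contact_substrate : forall i, substrate (p i);
  contact_oriented : outward_oriented p
}.

(* Main.v *)
Require Import Defs.
From HB Require Import structures.
From mathcomp Require Import all_boot all_order all_algebra.
From mathcomp Require Import all_classical all_reals all_analysis.
From mathcomp Require Import measurable_realfun ring lra.

Set Implicit Arguments.
Unset Strict Implicit.
Unset Printing Implicit Defensive.

Import Order.TTheory GRing.Theory Num.Theory.
Import numFieldNormedType.Exports.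

Local Open Scope ring_scope.

(* Testing the first equation with [w = v] and the second with [phi = H]
   eliminates the lumped integral of [H n . v] up to the Dirichlet energy of
   [H], which has the right sign; the third and fourth equations, tested with
   [lambda] and [kappa], and the symmetry of [a] give [a lambda v = 0]. Hence
   the integral of [grad X . grad v] is at most the contact-line integral.
   Since [tau v = X - id], [tau] times the former is at least
   [1/2 |grad X|^2 - 1/2 |grad id|^2] integrated over the surface, where
   [1/2 |grad X|^2] dominates the Jacobian of [X] and [|grad id|^2 = 2]: this
   bounds the variation of the area. With the half-step conormal, [tau] times
   the latter is exactly [cos theta] times the variation of the shoelace area,
   because the mixed terms telescope along the closed polygon. *)

(** * Vector algebra in three dimensions and the tangential projection *)

Lemma sum_ord3 (V : nmodType) (f : 'I_3 -> V) :
  \sum_(i < 3) f i = f 0 + f 1 + f 2.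
Proof.
rewrite !big_ord_recl big_ord0 addr0 addrA.
by congr (f _ + f _ + f _); apply: val_inj.
Qed.

Lemma ord3P (P : 'I_3 -> Prop) : P 0 -> P 1 -> P 2 -> forall i, P i.
Proof.
move=> P0 P1 P2 [[|[|[|//]]] lti].
- by rewrite (_ : Ordinal lti = 0) //; apply: val_inj.
- by rewrite (_ : Ordinal lti = 1) //; apply: val_inj.
- by rewrite (_ : Ordinal lti = 2) //; apply: val_inj.
Qed.

Lemma dotvE (R : realType) (x y : 'rV[R]_3) :
  dotv x y = x 0 0 * y 0 0 + x 0 1 * y 0 1 + x 0 2 * y 0 2.
Proof. exact: sum_ord3. Qed.

Lemma ord_max3 : ord_max = 2 :> 'I_3.
Proof. exact: val_inj. Qed.

Lemma crossvE (R : realType) (x y : 'rV[R]_3) :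
  (crossv x y 0 0 = x 0 1 * y 0 2 - x 0 2 * y 0 1) *
  (crossv x y 0 1 = x 0 2 * y 0 0 - x 0 0 * y 0 2) *
  (crossv x y 0 2 = x 0 0 * y 0 1 - x 0 1 * y 0 0).
Proof.
have s0 : ordS 0 = 1 :> 'I_3 by apply: val_inj.
have s1 : ordS 1 = 2 :> 'I_3 by apply: val_inj.
have s2 : ordS 2 = 0 :> 'I_3 by apply: val_inj.
by split; [split|]; rewrite mxE ?s0 ?s1 ?s2 ?s0.
Qed.

Lemma dotvv_ge0 (R : realType) (x : 'rV[R]_3) : 0 <= dotv x x.
Proof. by apply: sumr_ge0 => i _; rewrite -expr2 sqr_ge0. Qed.

Lemma dotvv_gt0 (R : realType) (x : 'rV[R]_3) : (0 < dotv x x) = (x != 0).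
Proof.
rewrite lt_neqAle dotvv_ge0 andbT eq_sym; congr negb; apply/eqP/eqP => [x0|->].
  apply/rowP => i; rewrite mxE; apply/eqP; rewrite -sqrf_eq0 expr2.
  by have /psumr_eq0P/(_ x0) -> : forall i, true -> 0 <= x 0 i * x 0 i
    by move=> j _; rewrite -expr2 sqr_ge0.
by rewrite dotvE !mxE; ring.
Qed.

Lemma sqr_enorm (R : realType) (x : 'rV[R]_3) : enorm x ^+ 2 = dotv x x.
Proof. by rewrite sqr_sqrtr ?dotvv_ge0. Qed.

Lemma enorm_gt0 (R : realType) (x : 'rV[R]_3) : (0 < enorm x) = (x != 0).
Proof. by rewrite sqrtr_gt0 dotvv_gt0. Qed.

Lemma dotvC (R : realType) (x y : 'rV[R]_3) : dotv x y = dotv y x.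
Proof. by rewrite !dotvE; ring. Qed.

Lemma dotvDr (R : realType) (x y z : 'rV[R]_3) :
  dotv x (y + z) = dotv x y + dotv x z.
Proof. by rewrite !dotvE !mxE; ring. Qed.

Lemma dotvZr (R : realType) (c : R) (x y : 'rV[R]_3) :
  dotv x (c *: y) = c * dotv x y.
Proof. by rewrite !dotvE !mxE; ring. Qed.

Lemma dotvDl (R : realType) (x y z : 'rV[R]_3) :
  dotv (x + y) z = dotv x z + dotv y z.
Proof. by rewrite !dotvE !mxE; ring. Qed.

Lemma dotvZl (R : realType) (c : R) (x y : 'rV[R]_3) :
  dotv (c *: x) y = c * dotv x y.
Proof. by rewrite !dotvE !mxE; ring. Qed.

Lemma dotv_delta (R : realType) (x : 'rV[R]_3) (i : 'I_3) :
  dotv (delta_mx 0 i) x = x 0 i.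
Proof.
rewrite /dotv (bigD1 i) //= big1 ?mxE ?eqxx ?mul1r ?addr0 // => j ji.
by rewrite mxE eqxx (negbTE ji) mul0r.
Qed.

(** By conversion, [normal T] is [unit_cross] of the edges [T 1 - T 0] and [T 2 - T 0]. *)
Definition unit_cross (R : realType) (e f : 'rV[R]_3) : 'rV[R]_3 :=
  (enorm (crossv e f))^-1 *: crossv e f.

(** Lagrange's identity: the right-hand side is the Gram determinant of [e] and [f]. *)
Lemma dotv_crossv (R : realType) (e f : 'rV[R]_3) :
  dotv (crossv e f) (crossv e f) = dotv e e * dotv f f - dotv e f ^+ 2.
Proof. by rewrite !dotvE !crossvE; ring. Qed.

(** Cramer's rule for the Gram system of the basis [e], [f] of the tangent plane. It turns
    tangential directions into combinations of triangle edges. *)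
Lemma tproj_decomp (R : realType) (e f x : 'rV[R]_3) :
  crossv e f != 0 ->
  tproj (unit_cross e f) x =
  (dotv (crossv e f) (crossv e f))^-1 *:
    ((dotv f f * dotv e x - dotv e f * dotv f x) *: e
     + (dotv e e * dotv f x - dotv e f * dotv e x) *: f).
Proof.
move=> ef0; set D := dotv _ (crossv e f).
have D0 : D != 0 by rewrite gt_eqF // dotvv_gt0.
apply: (scalerI D0); rewrite scalerA divff // scale1r.
have -> : tproj (unit_cross e f) x =
    x - (D^-1 * dotv (crossv e f) x) *: crossv e f.
  by rewrite /tproj /unit_cross dotvZl scalerA mulrAC -invfM -expr2 sqr_enorm.
rewrite scalerBr scalerA mulrA divff // mul1r /D.
have [[N0 N1] N2] := crossvE e f; move: (crossv e f) N0 N1 N2 => N N0 N1 N2.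
by apply/rowP; apply: ord3P; rewrite !mxE !dotvE N0 N1 N2; ring.
Qed.

Lemma dotv_unit_cross (R : realType) (e f : 'rV[R]_3) : crossv e f != 0 ->
  dotv (unit_cross e f) (unit_cross e f) = 1.
Proof.
move=> ef0; rewrite /unit_cross dotvZl dotvZr -sqr_enorm mulrA -invfM -expr2.
by rewrite mulVf // expf_neq0 // gt_eqF // enorm_gt0.
Qed.

Lemma dotv_tproj (R : realType) (e f x y : 'rV[R]_3) :
  crossv e f != 0 ->
  dotv (tproj (unit_cross e f) x) (tproj (unit_cross e f) y) =
  dotv x (tproj (unit_cross e f) y).
Proof.
move=> ef0; set n := unit_cross e f.
have nn : dotv n n = 1 by exact: dotv_unit_cross.
have nP : dotv n (tproj n y) = 0.
  by rewrite /tproj -scaleNr dotvDr dotvZr nn mulr1 subrr.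
by rewrite {1}/tproj -scaleNr dotvDl dotvZl nP mulr0 addr0.
Qed.

(** The quadratic form of the inverse Gram matrix of [e], [f], evaluated at the products of [x] with
    the two edges. *)
Lemma dotv_tproj_sqr (R : realType) (e f x : 'rV[R]_3) :
  crossv e f != 0 ->
  dotv (tproj (unit_cross e f) x) (tproj (unit_cross e f) x) =
  (dotv (crossv e f) (crossv e f))^-1 *
    (dotv f f * dotv x e ^+ 2 - 2 * dotv e f * dotv x e * dotv x f
     + dotv e e * dotv x f ^+ 2).
Proof.
move=> ef0; rewrite dotv_tproj // tproj_decomp // dotvZr dotvDr !dotvZr.
by rewrite (dotvC e x) (dotvC f x); ring.
Qed.

(* Multiplying the left-hand side by [dotv e e] turns it into the sum
   [dotv h h * dotv (crossv e f) (crossv e f) + dotv w w], where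
   [w := dotv e f *: h - dotv e e *: k], and [crossv h w] is a multiple of
   [crossv h k]; it remains to apply AM-GM. *)
Lemma area_le_dirichlet (R : realType) (e f h k : 'rV[R]_3) :
  crossv e f != 0 ->
  2 * enorm (crossv e f) * enorm (crossv h k) <=
  dotv f f * dotv h h - 2 * dotv e f * dotv h k + dotv e e * dotv k k.
Proof.
move=> ef0; set Q := leRHS.
have D0 : 0 < dotv (crossv e f) (crossv e f) by rewrite dotvv_gt0.
have A0 : 0 < dotv e e.
  rewrite lt_neqAle dotvv_ge0 andbT eq_sym; apply: contraTneq D0 => e0.
  by rewrite dotv_crossv e0 mul0r sub0r -leNgt oppr_le0 sqr_ge0.
pose w := dotv e f *: h + (- dotv e e) *: k.
have AQ : dotv e e * Q =
    dotv h h * dotv (crossv e f) (crossv e f) + dotv w w.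
  rewrite dotv_crossv /Q /w !(dotvDl, dotvDr, dotvZl, dotvZr) (dotvC k h); ring.
have hk : dotv e e ^+ 2 * dotv (crossv h k) (crossv h k) <=
    dotv h h * dotv w w.
  rewrite -subr_ge0 dotv_crossv.
  have -> : dotv h h * dotv w w -
      dotv e e ^+ 2 * (dotv h h * dotv k k - dotv h k ^+ 2) = dotv h w ^+ 2.
    by rewrite /w !(dotvDl, dotvDr, dotvZl, dotvZr) (dotvC k h); ring.
  exact: sqr_ge0.
have Q0 : 0 <= Q.
  by rewrite -(pmulr_rge0 _ A0) AQ addr_ge0 ?mulr_ge0 ?dotvv_ge0.
rewrite -ler_sqr ?nnegrE ?mulr_ge0 ?sqrtr_ge0 // !exprMn !sqr_enorm.
rewrite -(ler_pM2l (exprn_gt0 2 A0)) -exprMn AQ.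
have := sqr_ge0 (dotv h h * dotv (crossv e f) (crossv e f) - dotv w w).
have := ler_wpM2l (ltW D0) hk.
by nra.
Qed.

(** * Integrals and derivatives of affine functions *)

Lemma Rintegral_affine (R : realType) (L a b : R) : 0 < L ->
  \int[@lebesgue_measure R]_(s in `]0%R, L[%classic) (a + b * s) =
  L * (a + b * L / 2).
Proof.
move=> L0.
have cf : continuous (fun s : R => a + b * s).
  by move=> x; apply: cvgD; [exact: cvg_cst | apply: cvgMr; exact: cvg_id].
pose G := fun s : R => a * s + (b / 2) * (s * s).
have dG (x : R) : is_derive x 1 G (a + b * x).
  rewrite /G; apply: is_derive_eq.
  by rewrite /GRing.scale /=; field.
have cG : continuous G.
  move=> x; apply: differentiable_continuous; apply/derivable1_diffP.
  by have [] := dG x.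
(* Endpoints are null sets; on the closed interval the fundamental theorem of calculus applies with
   the primitive [G]. *)
rewrite /Rintegral integral_itv_bndo_bndc; last first.
  apply/measurable_EFinP; apply: measurable_funTS.
  exact: continuous_measurable_fun.
rewrite integral_itv_obnd_cbnd; last first.
  apply/measurable_EFinP; apply: measurable_funTS.
  exact: continuous_measurable_fun.
rewrite (@continuous_FTC2 _ _ G) //=.
- by rewrite /G; field.
- exact: continuous_subspaceT.
- split.
  + by move=> x _; have [] := dG x.
  + by apply: cvg_at_right_filter; exact: cG.
  + by apply: cvg_at_left_filter; exact: cG.
- by move=> x _; rewrite derive1E; have [] := dG x.
Qed.

Lemma Rintegral_cst_itv (R : realType) (L a : R) : 0 < L ->
  \int[@lebesgue_measure R]_(s in `]0%R, L[%classic) a = L * a.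
Proof.
move=> L0; have := Rintegral_affine a 0 L0.
under eq_Rintegral do rewrite mul0r addr0.
by move=> ->; ring.
Qed.

(** The difference quotient is constant near 0, so no regularity of [f] away from this line is
    required. *)
Lemma derive_near_affine (R : realType) (V W : normedModType R)
    (f : V -> W) (x d : V) (e : W) :
  (\forall h \near dnbhs (0 : R), f (h *: d + x) = f x + h *: e) ->
  'D_d f x = e.
Proof.
move=> fE; rewrite /derive; apply: norm_cvg_lim; apply: cvg_near_cst.
near=> h; rewrite /= /shift.
have -> : f (h *: d + x) = f x + h *: e by near: h.
rewrite addrC addKr scalerA mulVf ?scale1r //.
near: h; exact: nbhs_dnbhs_neq.
Unshelve. all: by end_near. Qed.

Lemma near0_gt0_affine (R : realType) (s a : R) : 0 < s ->
  \forall h \near dnbhs (0 : R), 0 < s + h * a.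
Proof.
move=> s0; apply: nbhs_dnbhs; near=> h.
have : `|h * a| < s.
  (* The summand 1 keeps the divisor positive when [a] is 0. *)
  have a1 : 0 < `|a| + 1 by rewrite ltr_wpDl.
  have hs : `|h| < s / (`|a| + 1).
    near: h; apply: (@nbhs0_lt _ R); exact: divr_gt0.
  rewrite normrM (le_lt_trans (y := `|h| * (`|a| + 1))) //.
    by rewrite ler_wpM2l // lerDl.
  by rewrite -ltr_pdivlMr.
by rewrite ltr_norml => /andP[]; lra.
Unshelve. all: by end_near. Qed.

(** * Tangential gradients and integrals on a flat triangle *)

Lemma triangle_param (R : realType) (T : 'I_3 -> 'rV[R]_3) (s t : R) :
  0 <= s -> 0 <= t -> s + t <= 1 ->
  triangle T (T 0 + s *: (T 1 - T 0) + t *: (T 2 - T 0)).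
Proof.
move=> s0 t0 st.
exists (fun i => if i == 0 then 1 - s - t else if i == 1 then s else t).
split => //; rewrite ?sum_ord3 /=.
- by apply: ord3P => //=; lra.
- by ring.
- by apply/rowP => i; rewrite !mxE; ring.
Qed.

Lemma triangle_vertex (R : realType) (T : 'I_3 -> 'rV[R]_3) (i : 'I_3) :
  triangle T (T i).
Proof.
exists (fun j => (i == j)%:R); split => //.
- rewrite (bigD1 i) //= eqxx big1 ?addr0 // => j ji.
  by rewrite eq_sym (negbTE ji).
- rewrite (bigD1 i) //= eqxx scale1r big1 ?addr0 // => j ji.
  by rewrite eq_sym (negbTE ji) scale0r.
Qed.

(** Each projected basis vector combines the two edges, so a small step along it from an interior
    point stays in the triangle, where [u] is affine. *)
Lemma tgrad_affine (R : realType) (T : 'I_3 -> 'rV[R]_3) (u : 'rV[R]_3 -> R)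
    (g : 'rV[R]_3) (c s t : R) :
  area_vec T != 0 ->
  (forall x, triangle T x -> u x = dotv g x + c) ->
  0 < s -> 0 < t -> s + t < 1 ->
  tgrad (normal T) u (T 0 + s *: (T 1 - T 0) + t *: (T 2 - T 0)) =
  tproj (normal T) g.
Proof.
move=> T0 uE s0 t0 st; apply/rowP => j; rewrite mxE.
set x := T 0 + _ + _.
transitivity (dotv g (tproj (normal T) (delta_mx 0 j))); last first.
  by rewrite -dotv_delta -(dotv_tproj _ _ T0) dotvC dotv_tproj.
have := tproj_decomp (delta_mx 0 j) T0.
rewrite scalerDr !scalerA; set al := _ * (_ - _); set be := _ * (_ - _).
rewrite -/(area_vec T) -/(normal T) => ->.
apply: derive_near_affine; near=> h.
have inT (a b : R) : 0 <= a -> 0 <= b -> a + b <= 1 ->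
  u (T 0 + a *: (T 1 - T 0) + b *: (T 2 - T 0)) =
  dotv g (T 0 + a *: (T 1 - T 0) + b *: (T 2 - T 0)) + c.
  by move=> *; apply/uE/triangle_param.
have -> : h *: (al *: (T 1 - T 0) + be *: (T 2 - T 0)) + x =
    T 0 + (s + h * al) *: (T 1 - T 0) + (t + h * be) *: (T 2 - T 0).
  by apply/rowP => i; rewrite !mxE; ring.
have hs : 0 < s + h * al by near: h; exact: near0_gt0_affine.
have ht : 0 < t + h * be by near: h; exact: near0_gt0_affine.
(* This is the barycentric coordinate of the displaced point with respect to [T 0]. *)
have hst : 0 < 1 - s - t + h * (- al - be).
  by near: h; apply: near0_gt0_affine; lra.
rewrite !inT; [|lra..].
by rewrite !(dotvDr, dotvZr) /GRing.scale /=; ring.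
Unshelve. all: by end_near. Qed.

(** The reference triangle has area 1/2, which cancels the factor 2 in the Jacobian. *)
Lemma int_triangle_cst (R : realType) (T : 'I_3 -> 'rV[R]_3)
    (f : 'rV[R]_3 -> R) (k : R) :
  (forall s t, 0 < s -> 0 < t -> s + t < 1 ->
    f (T 0 + s *: (T 1 - T 0) + t *: (T 2 - T 0)) = k) ->
  int_triangle T f = area T * k.
Proof.
move=> fk; rewrite /int_triangle.
under eq_Rintegral => s.
  rewrite inE /= in_itv /= => /andP[s0 s1].
  under eq_Rintegral => t.
    rewrite inE /= in_itv /= => /andP[t0 ts].
    rewrite fk //; last by rewrite addrC -ltrBrDr.
    over.
  rewrite Rintegral_cst_itv ?subr_gt0 //.
  rewrite (_ : _ * k = k + (- k) * s); last by ring.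
  over.
by rewrite Rintegral_affine //; field.
Qed.

Lemma int_triangle_tgrad (R : realType) (T : 'I_3 -> 'rV[R]_3)
    (u w : 'rV[R]_3 -> R) (g g' : 'rV[R]_3) (c c' : R) :
  area_vec T != 0 ->
  (forall x, triangle T x -> u x = dotv g x + c) ->
  (forall x, triangle T x -> w x = dotv g' x + c') ->
  int_triangle T (fun x => dotv (tgrad (normal T) u x) (tgrad (normal T) w x)) =
  area T * dotv (tproj (normal T) g) (tproj (normal T) g').
Proof.
move=> T0 uE wE; apply: int_triangle_cst => s t s0 t0 st.
by rewrite (tgrad_affine T0 uE) // (tgrad_affine T0 wE).
Qed.

Lemma int_triangle_tgradv (R : realType) (T : 'I_3 -> 'rV[R]_3)
    (v w : 'rV[R]_3 -> 'rV[R]_3) (g g' : 'I_3 -> 'rV[R]_3) (c c' : 'I_3 -> R) :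
  area_vec T != 0 ->
  (forall i x, triangle T x -> Defs.comp v i x = dotv (g i) x + c i) ->
  (forall i x, triangle T x -> Defs.comp w i x = dotv (g' i) x + c' i) ->
  int_triangle T
    (fun x => frobenius (tgradv (normal T) v x) (tgradv (normal T) w x)) =
  area T * \sum_(i < 3) dotv (tproj (normal T) (g i)) (tproj (normal T) (g' i)).
Proof.
move=> T0 vE wE; apply: int_triangle_cst => s t s0 t0 st.
apply: eq_bigr => i _; apply: eq_bigr => j _.
rewrite [tgradv _ v _ i j]mxE [tgradv _ w _ i j]mxE.
by rewrite (tgrad_affine T0 (vE i)) // (tgrad_affine T0 (wE i)).
Qed.

(** * Area variation against the Dirichlet energy *)

Lemma sum_tproj_delta (R : realType) (e f : 'rV[R]_3) : crossv e f != 0 ->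
  \sum_(i < 3) dotv (tproj (unit_cross e f) (delta_mx 0 i))
                    (tproj (unit_cross e f) (delta_mx 0 i)) = 2.
Proof.
move=> ef0; have nn := dotv_unit_cross ef0.
(* The sum, which is the squared gradient of the identity, becomes the trace of the projection, 3
   minus the squared length of the normal. *)
rewrite sum_ord3 !dotv_tproj // !dotv_delta.
move: nn; move: (unit_cross e f) => n nn.
have E (i : 'I_3) : tproj n (delta_mx 0 i) 0 i = 1 - n 0 i * n 0 i.
  by rewrite /tproj dotvC dotv_delta !mxE !eqxx.
rewrite !E; move: nn; rewrite dotvE => nn.
by rewrite -[X in _ = X]/(1 + 1) -{1}nn; lra.
Qed.

(** Here [h] and [k] are the images of the edges under the linear map with rows [G i]: its Jacobian
    is at most half its squared tangential gradient. *)
Lemma image_area_le (R : realType) (e f h k : 'rV[R]_3) (G : 'I_3 -> 'rV[R]_3) :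
  crossv e f != 0 ->
  (forall i, h 0 i = dotv (G i) e) -> (forall i, k 0 i = dotv (G i) f) ->
  2 * enorm (crossv h k) <=
  enorm (crossv e f) * \sum_(i < 3)
    dotv (tproj (unit_cross e f) (G i)) (tproj (unit_cross e f) (G i)).
Proof.
move=> ef0 hE kE; have N0 : 0 < enorm (crossv e f) by rewrite enorm_gt0.
have -> : \sum_(i < 3) dotv (tproj (unit_cross e f) (G i))
                            (tproj (unit_cross e f) (G i)) =
    (enorm (crossv e f) ^+ 2)^-1 *
    (dotv f f * dotv h h - 2 * dotv e f * dotv h k + dotv e e * dotv k k).
  rewrite sqr_enorm !(dotvE h) !(dotvE k) sum_ord3 !dotv_tproj_sqr //.
  by rewrite !hE !kE; ring.
rewrite expr2 invfM !mulrA divff ?gt_eqF // mul1r ler_pdivlMl // mulrCA mulrA.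
exact: area_le_dirichlet.
Qed.

Lemma area_variation_le (R : realType) (T : 'I_3 -> 'rV[R]_3)
    (v : 'rV[R]_3 -> 'rV[R]_3) (tau : R) :
  area_vec T != 0 -> (forall i, affine_on (triangle T) (Defs.comp v i)) ->
  area (fun j => T j + tau *: v (T j)) - area T <=
  tau * int_triangle T (fun x =>
    frobenius (tgradv (normal T) (fun y => y + tau *: v y) x)
              (tgradv (normal T) v x)).
Proof.
move=> T0 vA; have [g /boolp.choice[c vE]] := boolp.choice vA.
(* The gradient of the [i]-th component of the deformation [id + tau v]. *)
pose G i := delta_mx 0 i + tau *: g i.
have XE i x : triangle T x ->
    Defs.comp (fun y => y + tau *: v y) i x = dotv (G i) x + tau * c i.
  move=> Tx; rewrite /Defs.comp !mxE -/(Defs.comp v i x) vE //.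
  by rewrite /G dotvDl dotvZl dotv_delta; ring.
rewrite (int_triangle_tgradv T0 XE vE).
have E j i : (T j + tau *: v (T j) - (T 0 + tau *: v (T 0))) 0 i =
    dotv (G i) (T j - T 0).
  rewrite [LHS]mxE [X in _ + X]mxE.
  rewrite -!/(Defs.comp (fun y => y + tau *: v y) i _).
  rewrite !XE; try exact: triangle_vertex.
  by rewrite -(scaleN1r (T 0)) dotvDr dotvZr; ring.
have := image_area_le T0 (E 1) (E 2); rewrite -/(area_vec T).
have := sum_tproj_delta T0.
rewrite -/(area_vec T) -/(normal T).
set P := tproj (normal T).
have PG i : P (G i) = P (delta_mx 0 i) + tau *: P (g i).
  by rewrite /P /tproj /G dotvDr dotvZr; apply/rowP => j; rewrite !mxE; ring.
have le_i i : dotv (P (G i)) (P (G i)) -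
    dotv (P (delta_mx 0 i)) (P (delta_mx 0 i)) <=
    2 * (tau * dotv (P (G i)) (P (g i))).
  rewrite -subr_ge0.
  (* The gap between the two sides is exactly this square. *)
  apply: le_trans (dotvv_ge0 (tau *: P (g i))) _.
  rewrite PG; move: (P (delta_mx 0 i)) (P (g i)) => y z.
  rewrite !(dotvDl, dotvDr, dotvZl, dotvZr) (dotvC z y).
  by rewrite le_eqVlt; apply/orP; left; apply/eqP; ring.
have := @ler_sum _ _ (index_enum 'I_3) xpredT _ _ (fun i _ => le_i i).
rewrite sumrB -!mulr_sumr /area -/(area_vec T).
set S1 := \sum_(i < 3) _; set S2 := \sum_(i < 3) _; set S3 := \sum_(i < 3) _.
rewrite -/(area_vec (fun j => T j + tau *: v (T j))).
set a1 := enorm _; set a0 := enorm _.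
have a00 : 0 <= a0 by exact: sqrtr_ge0.
move=> le1 eq2 le2.
(* Scaling by [a0], twice the area of [T], makes the gradient bound comparable with the image area
   bound [le2]. *)
have := ler_wpM2l a00 le1; rewrite eq2.
by nra.
Qed.

(** * The contact-line integral and the shoelace area *)

Lemma e3E (R : realType) (i : 'I_3) : e3 R 0 i = (i == 2)%:R.
Proof. by rewrite mxE eqxx ord_max3. Qed.

(** At a point strictly inside the edge, small steps of either sign stay on the edge, where [f] is
    affine. *)
Lemma arc_deriv_edge (R : realType) (N : nat) (p : 'I_N -> 'rV[R]_3)
    (f : 'rV[R]_3 -> 'rV[R]_3) (i : 'I_N) (s : R) :
  0 < s -> s < edge_length p i ->
  (forall r, 0 <= r <= 1 -> f (p i + r *: (p (ordS i) - p i)) =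
                            f (p i) + r *: (f (p (ordS i)) - f (p i))) ->
  arc_deriv p i f (p i + s *: edge_tangent p i) =
  (edge_length p i)^-1 *: (f (p (ordS i)) - f (p i)).
Proof.
move=> s0 sL fE; set L := edge_length p i in sL *.
have L0 : 0 < L := lt_trans s0 sL.
apply: derive_near_affine; near=> h.
have fs r : 0 <= r -> r <= L -> f (p i + r *: edge_tangent p i) =
    f (p i) + (r / L) *: (f (p (ordS i)) - f (p i)).
  move=> r0 rL; rewrite /edge_tangent -/L scalerA fE //.
  by rewrite divr_ge0 ?(ltW L0) //= ler_pdivrMr // mul1r.
have sh0 : 0 < s + h * 1 by near: h; exact: near0_gt0_affine.
have shL : 0 < L - s + h * (- 1).
  by near: h; apply: near0_gt0_affine; rewrite subr_gt0.
have -> : h *: edge_tangent p i + (p i + s *: edge_tangent p i) =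
    p i + (s + h) *: edge_tangent p i.
  by rewrite scalerDl addrCA [X in _ + X]addrC.
by rewrite !fs; [|lra..]; apply/rowP => j; rewrite !mxE; ring.
Unshelve. all: by end_near. Qed.

Lemma shoelace_variation (R : realType) (N : nat) (p p' : 'I_N -> 'rV[R]_3) :
  \sum_(i < N) dotv
    (crossv (2^-1 *: (p (ordS i) - p i + (p' (ordS i) - p' i))) (e3 R))
    (2^-1 *: (p' i - p i + (p' (ordS i) - p (ordS i)))) =
  signed_area p' - signed_area p.
Proof.
(* The mixed terms of the [i]-th edge are [B i - B (ordS i)]; their sum vanishes by cyclic
   reindexing. *)
pose B i := 2^-1 * crossv (p i) (p' i) 0 2.
rewrite /signed_area !mulr_sumr -sumrB.
transitivity (\sum_(i < N) ((2^-1 * crossv (p' i) (p' (ordS i)) 0 ord_max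
    - 2^-1 * crossv (p i) (p (ordS i)) 0 ord_max) + (B i - B (ordS i)))).
  apply: eq_bigr => i _; rewrite ord_max3 dotvE /B !crossvE !e3E !mxE /=.
  by field.
rewrite [LHS]big_split /= [X in _ + X]sumrB.
rewrite [X in _ - X](_ : _ = \sum_(i < N) B i).
  by rewrite subrr addr0.
by rewrite [RHS](reindex_inj (@ordS_inj N)).
Qed.

(** On each edge the conormal is constant and [v] is affine, so the integral is the edge length
    times the midpoint value. The length cancels against the arc-length derivative, leaving the sum
    of [shoelace_variation]. *)
Lemma int_polygon_conormal (R : realType) (N : nat) (p : 'I_N -> 'rV[R]_3)
    (v : 'rV[R]_3 -> 'rV[R]_3) (tau k : R) :
  (forall i, p i != p (ordS i)) ->
  (forall i r, 0 <= r <= 1 -> v (p i + r *: (p (ordS i) - p i)) =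
                              v (p i) + r *: (v (p (ordS i)) - v (p i))) ->
  tau * int_polygon p (fun i x =>
    k * dotv (conormal_half p (fun x => x + tau *: v x) i x) (v x)) =
  k * (signed_area (fun i => p i + tau *: v (p i)) - signed_area p).
Proof.
move=> pS vE; rewrite -shoelace_variation !mulr_sumr; apply: eq_bigr => i _.
set X := fun x => x + tau *: v x.
set L := edge_length p i.
have L0 : 0 < L by rewrite enorm_gt0 subr_eq0 eq_sym.
pose c := crossv (2^-1 *: (L^-1 *: (p (ordS i) - p i) +
                           L^-1 *: (X (p (ordS i)) - X (p i)))) (e3 R).
under eq_Rintegral => s.
  rewrite inE /= in_itv /= => /andP[s0 sL].
  rewrite /conormal_half arc_deriv_edge // arc_deriv_edge //; last first.
    by move=> r r01; rewrite /X vE //; apply/rowP => j; rewrite !mxE; ring.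
  rewrite -/L -/c /edge_tangent -/L scalerA vE; last first.
    by rewrite divr_ge0 ?(ltW L0) ?(ltW s0) //= ler_pdivrMr // mul1r ltW.
  rewrite dotvDr dotvZr.
  rewrite (_ : k * _ = k * dotv c (v (p i)) +
     (k * dotv c (v (p (ordS i)) - v (p i)) / L) * s); last by ring.
  over.
rewrite Rintegral_affine // /c /X !dotvE !crossvE !e3E !mxE /=.
by field; rewrite gt_eqF.
Qed.

(** * Affine fields on triangles and boundary edges, and the stability estimate *)

Lemma triangle_convex (R : realType) (T : 'I_3 -> 'rV[R]_3) (x y : 'rV[R]_3)
    (r : R) :
  0 <= r <= 1 -> triangle T x -> triangle T y -> triangle T (x + r *: (y - x)).
Proof.
move=> /andP[r0 r1] [b [b0 b1 _ ->]] [b' [b'0 b'1 _ ->]].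
exists (fun i => b i + r * (b' i - b i)); split => //.
- by move=> i; have := b0 i; have := b'0 i; nra.
- by rewrite big_split /= -mulr_sumr sumrB b1 b'1; ring.
- rewrite -sumrB scaler_sumr -big_split; apply: eq_bigr => i _ /=.
  by rewrite scalerDl -scalerA scalerBl.
Qed.

Lemma affine_on_segment (R : realType) (A : set 'rV[R]_3)
    (v : 'rV[R]_3 -> 'rV[R]_3) (x y : 'rV[R]_3) (r : R) :
  (forall i, affine_on A (Defs.comp v i)) ->
  A x -> A y -> A (x + r *: (y - x)) ->
  v (x + r *: (y - x)) = v x + r *: (v y - v x).
Proof.
move=> vA Ax Ay Az; apply/rowP => i; have [g [c vE]] := vA i.
rewrite !mxE -!/(Defs.comp v i _) !vE //.
by rewrite -(scaleN1r x) !(dotvDr, dotvZr); ring.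
Qed.

Lemma Xh_affine (R : realType) (F : finType) (q : F -> 'I_3 -> 'rV[R]_3)
    (v : 'rV[R]_3 -> 'rV[R]_3) (K : F) (i : 'I_3) :
  Xh q v -> affine_on (triangle (q K)) (Defs.comp v i).
Proof.
move=> [[_ v0] [_ v1] [[_ v2] _]].
by move: i; apply: ord3P => //; rewrite -ord_max3.
Qed.

(** A boundary edge has exactly one incident triangle; this triangle makes finite element fields
    affine along the edge. *)
Lemma contact_line_edge (R : realType) (F : finType) (q : F -> 'I_3 -> 'rV[R]_3)
    (N : nat) (p : 'I_N -> 'rV[R]_3) (i : 'I_N) :
  contact_line q p ->
  p i != p (ordS i) /\
  exists K, triangle (q K) (p i) /\ triangle (q K) (p (ordS i)).
Proof.
move=> cl; have [_] := contact_boundary cl (p i) (p (ordS i)).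
case; first by exists i; left.
move=> neq card1; split => //.
have : (0 < #|[set K | is_vertex q K (p i) &&
                     is_vertex q K (p (ordS i))]%SET|)%N by rewrite card1.
rewrite card_gt0 => /set0Pn[K]; rewrite inE.
move=> /andP[/existsP[j /eqP <-] /existsP[j' /eqP <-]].
by exists K; split; exact: triangle_vertex.
Qed.

Lemma dirichlet_ge0 (R : realType) (F : finType) (q : F -> 'I_3 -> 'rV[R]_3)
    (u : 'rV[R]_3 -> R) :
  triangulated_surface q -> Sh q u ->
  0 <= int_surface q (fun K x => dotv (tgrad (normal (q K)) u x)
                                      (tgrad (normal (q K)) u x)).
Proof.
move=> sq [_ uA]; apply: sumr_ge0 => K _; have [g [c uE]] := uA K.
rewrite (int_triangle_tgrad (surface_nondegenerate sq K) uE uE).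
by rewrite !mulr_ge0 ?dotvv_ge0 ?invr_ge0 ?sqrtr_ge0.
Qed.

Theorem theorem3p1 (R : realType) (tau theta : R)
    (F : finType) (q : F -> 'I_3 -> 'rV[R]_3)
    (N : nat) (p : 'I_N -> 'rV[R]_3)
    (a : ('rV[R]_3 -> 'rV[R]_3) -> ('rV[R]_3 -> 'rV[R]_3) -> R)
    (v lambda : 'rV[R]_3 -> 'rV[R]_3) (H kappa : 'rV[R]_3 -> R) :
  let n := fun K => normal (q K) in
  let X := fun x => x + tau *: v x in
  0 < tau ->
  triangulated_surface q ->
  contact_line q p ->
  symmetric_bilinear_form q a ->
  Xh q v -> Sh q H -> Xh q lambda -> Sh q kappa ->
  (forall w, Xh q w ->
     - int_lumped q (fun K x => dotv (H x *: n K) (w x))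
     + int_surface q (fun K x => frobenius (tgradv (n K) X x)
                                           (tgradv (n K) w x))
     - int_polygon p (fun i x => cos theta * dotv (conormal_half p X i x) (w x))
     = a lambda w) ->
  (forall phi, Sh q phi ->
     int_lumped q (fun K x => dotv (v x) (n K) * phi x)
     + int_surface q (fun K x => dotv (tgrad (n K) H x) (tgrad (n K) phi x))
     = 0) ->
  (forall eta, Xh q eta ->
     a v eta = int_lumped q (fun K x => dotv (kappa x *: n K) (eta x))) ->
  (forall phi, Sh q phi ->
     int_lumped q (fun K x => dotv (lambda x) (n K) * phi x) = 0) ->
  (\sum_K area (fun j => X (q K j))) - cos theta * signed_area (fun i => X (p i))
  <= (\sum_K area (q K)) - cos theta * signed_area p.
Proof.
move=> n X tau0 sq cl sa vX HS lX kS eq_w eq_phi eq_eta eq_lambda.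
have lumpedE (k : 'rV[R]_3 -> R) (w : 'rV[R]_3 -> 'rV[R]_3) :
    int_lumped q (fun K x => dotv (k x *: n K) (w x)) =
    int_lumped q (fun K x => dotv (w x) (n K) * k x).
  apply: eq_bigr => K _; congr (_ * _); apply: eq_bigr => j _.
  by rewrite dotvZl dotvC mulrC.
have a0 : a lambda v = 0.
  by rewrite (form_sym sa) // eq_eta // lumpedE eq_lambda.
have := eq_w v vX; rewrite a0 lumpedE.
have := eq_phi H HS; have := dirichlet_ge0 sq HS; rewrite -/n.
set I1 := int_lumped _ _; set I2 := int_surface _ _.
set I3 := int_surface _ _; set I4 := int_polygon _ _ => I2ge0 eqH eqv.
(* The tested equations read [I1 + I2 = 0] and [- I1 + I3 - I4 = 0], so [I4 - I3] is the Dirichlet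
   energy [I2]. *)
have I34 : I3 <= I4 by lra.
have bdry : tau * I4 =
    cos theta * (signed_area (fun i => X (p i)) - signed_area p).
  apply: int_polygon_conormal => [i|i r r01].
    by have [] := contact_line_edge i cl.
  have [_ [K [Kp Kp']]] := contact_line_edge i cl.
  apply: (@affine_on_segment _ (triangle (q K))) => //.
    by move=> j; exact: Xh_affine.
  exact: triangle_convex.
have surf : \sum_K area (fun j => X (q K j)) - \sum_K area (q K) <= tau * I3.
  rewrite -sumrB mulr_sumr; apply: ler_sum => K _.
  apply: area_variation_le; first exact: surface_nondegenerate.
  by move=> i; exact: Xh_affine.
have := ler_wpM2l (ltW tau0) I34.
by rewrite bdry; lra.
Qed.
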